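(* Let $\mathcal{L}$ be a linear space of gambles, $\alpha\in\,]0,1[$ and $P$ a probability on $\bigcup_{X\in\mathcal{L}}\{(X\leq x):x\in\mathbb{R}\}$. Define $\underline{P}^V_\alpha$ as $$\underline{P}^V_\alpha(X)=-VaR_\alpha(X)=\inf\{x\in\mathbb{R}:P(X\leq x)>\alpha\},\quad\forall X\in\mathcal{L}.$$ Then $\underline{P}^V_\alpha$ is a centered $2$-convex lower prevision on $\mathcal{L}$.
   Context: Fix a partition $\mathbb{P}$ of the sure event $\Omega$ into atoms. A gamble is a bounded function $X:\mathbb{P}\to\mathbb{R}$; $(X\leq x)$ denotes the event $\{\omega\in\mathbb{P}:X(\omega)\leq x\}$. A probability on a set of events is a coherent precise probability in de Finetti's sense, i.e. the restriction of a finitely additive probability defined on the powerset of $\mathbb{P}$. For a gamble $X$ and $\alpha\in\,]0,1[$, the Value-at-Risk of $X$ at level $\alpha$ is $VaR_\alpha(X)=-\inf\{x\in\mathbb{R}:P(X\leq x)>\alpha\}$. A lower prevision $\underline{P}:\mathcal{L}\to\mathbb{R}$ on a set of (unconditional) gambles is $2$-convex iff $\sup\{(X_1-\underline{P}(X_1))-(X_0-\underline{P}(X_0))\}\geq 0$ for all $X_0,X_1\in\mathcal{L}$; it is centered iff $0\in\mathcal{L}$ and $\underline{P}(0)=0$. *)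

(* Defs.v *)
(* MathComp-Analysis.  The atoms of the partition are the points of a type T,
   events are sets of atoms.  A map on a set L of gambles (or on a set E of
   events) is a total function of which only the values on L (on E) are used. *)
From mathcomp Require Import all_boot all_order all_algebra.
From mathcomp Require Import all_classical all_reals all_analysis.
Set Implicit Arguments.
Unset Strict Implicit.
Unset Printing Implicit Defensive.
Import Order.TTheory GRing.Theory Num.Theory.
Import numFieldNormedType.Exports.
Local Open Scope classical_set_scope.
Local Open Scope ring_scope.

Definition gamble (T : Type) (R : realType) (X : T -> R) : Prop :=
  bounded_fun X.

Definition linear_space_of_gambles (T : Type) (R : realType)
    (L : set (T -> R)) : Prop :=
  [/\ forall X, L X -> gamble X,
      L (cst 0) &
      forall (a b : R) (X Y : T -> R),
        L X -> L Y -> L (fun w => a * X w + b * Y w)].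

Definition finitely_additive_probability (T : Type) (R : realType)
    (Q : set T -> R) : Prop :=
  [/\ forall A, 0 <= Q A,
      Q setT = 1 &
      forall A B, A `&` B = set0 -> Q (A `|` B) = Q A + Q B].

Definition probability_on (T : Type) (R : realType)
    (E : set (set T)) (P : set T -> R) : Prop :=
  exists2 Q : set T -> R,
    finitely_additive_probability Q & forall A, E A -> P A = Q A.

Definition event_le (T : Type) (R : realType) (X : T -> R) (x : R) : set T :=
  [set w | X w <= x].

Definition VaR_set (T : Type) (R : realType) (alpha : R) (P : set T -> R)
    (X : T -> R) : set R :=
  [set x | alpha < P (event_le X x)].

(* [inf] is 0 on sets that are empty or unbounded below, so that this is the
   Value-at-Risk only when [has_inf (VaR_set alpha P X)]. *)
Definition VaR (T : Type) (R : realType) (alpha : R) (P : set T -> R)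
    (X : T -> R) : R :=
  - inf (VaR_set alpha P X).

Definition lower_prevision_VaR (T : Type) (R : realType) (alpha : R)
    (P : set T -> R) (X : T -> R) : R :=
  - VaR alpha P X.

(* The supremum over the atoms is taken in the extended reals, where it has no
   default value; on bounded functions it is the real supremum. *)
Definition two_convex (T : Type) (R : realType) (L : set (T -> R))
    (lP : (T -> R) -> R) : Prop :=
  forall X0 X1, L X0 -> L X1 ->
    (0 <= ereal_sup
      (range (fun w : T => ((X1 w - lP X1) - (X0 w - lP X0))%:E)))%E.

Definition centered (T : Type) (R : realType) (L : set (T -> R))
    (lP : (T -> R) -> R) : Prop :=
  L (cst 0) /\ lP (cst 0) = 0.

(* Main.v *)
(* Translation invariance and monotonicity drive the argument: if the supremum
   of (X1 - m1) - (X0 - m0) were bounded by some r < 0, with m0 and m1 the two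
   quantiles, then X1 <= X0 + c pointwise for c = m1 - m0 + r, so the
   alpha-quantile m1 of X1 would be at most m0 + c = m1 + r < m1. *)
Require Import Defs.
From mathcomp Require Import all_boot all_order all_algebra.
From mathcomp Require Import all_classical all_reals all_analysis.
From mathcomp Require Import lra.
Set Implicit Arguments.
Unset Strict Implicit.
Unset Printing Implicit Defensive.
Import Order.TTheory GRing.Theory Num.Theory.
Import numFieldNormedType.Exports.
Local Open Scope classical_set_scope.
Local Open Scope ring_scope.

Section FinitelyAdditive.
Variables (T : Type) (R : realType) (Q : set T -> R).
Hypothesis hQ : finitely_additive_probability Q.

Lemma finitely_additive_set0 : Q set0 = 0.
Proof.
by case: hQ => _ _ /(_ set0 set0 (setI0 _)); rewrite setU0 => h; lra.
Qed.

Lemma finitely_additive_le (A B : set T) : A `<=` B -> Q A <= Q B.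
Proof.
move=> AB; case: hQ => Q0 _ QD.
by rewrite -(setDUK AB) QD ?setDIK// lerDl.
Qed.

End FinitelyAdditive.

Lemma lower_prevision_VaRE (T : Type) (R : realType) (alpha : R)
    (P : set T -> R) (X : T -> R) :
  lower_prevision_VaR alpha P X = inf (VaR_set alpha P X).
Proof. exact: opprK. Qed.

Section Quantile.
Variables (T : Type) (R : realType) (L : set (T -> R)) (alpha : R).
Variable P : set T -> R.
Hypothesis hP : probability_on (\bigcup_(X in L) range (event_le X)) P.

(** [P] is controlled only on the events generated by [L], where it agrees with its finitely
    additive extension [Q]. Membership of both gambles in [L] lets monotonicity be borrowed from
    [Q]. *)
Lemma event_le_mono (X Y : T -> R) (x y : R) : L X -> L Y ->
  event_le X x `<=` event_le Y y -> P (event_le X x) <= P (event_le Y y).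
Proof.
move=> LX LY XY; case: hP => Q hQ PQ.
rewrite !PQ; first exact: finitely_additive_le.
  by exists Y => //; exists y.
by exists X => //; exists x.
Qed.

Lemma event_le_full (X : T -> R) (x : R) : L X ->
  (forall w, X w <= x) -> P (event_le X x) = 1.
Proof.
move=> LX Xx; case: hP => Q [_ Q1 _] ->; last by exists X => //; exists x.
by rewrite (_ : event_le X x = setT)// -subTset => w _; exact: Xx.
Qed.

Lemma event_le_empty (X : T -> R) (x : R) : L X ->
  (forall w, x < X w) -> P (event_le X x) = 0.
Proof.
move=> LX Xx; case: hP => Q hQ ->; last by exists X => //; exists x.
rewrite (_ : event_le X x = set0) ?finitely_additive_set0// -subset0 => w.
by rewrite /event_le /= leNgt Xx.
Qed.

Hypothesis halpha : 0 < alpha < 1.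

(** Here [alpha < 1] enters: the event at level [x] is sure, so its probability 1 exceeds
    [alpha]. *)
Lemma VaR_set_ub (X : T -> R) (x : R) : L X ->
  (forall w, X w <= x) -> VaR_set alpha P X x.
Proof.
by move=> LX Xx; rewrite /VaR_set /= event_le_full//; case/andP: halpha.
Qed.

(** Here [0 < alpha] enters: below [m] the event is empty, and its probability 0 cannot exceed
    [alpha]. *)
Lemma VaR_set_lbound (X : T -> R) (m : R) : L X ->
  (forall w, m <= X w) -> lbound (VaR_set alpha P X) m.
Proof.
move=> LX mX x; rewrite /VaR_set /= leNgt; apply: contraTN => xm.
rewrite -leNgt event_le_empty; [by case/andP: halpha => /ltW|exact: LX|].
by move=> w; exact: lt_le_trans (mX w).
Qed.

Lemma has_inf_VaR_set (X : T -> R) : L X -> bounded_fun X ->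
  has_inf (VaR_set alpha P X).
Proof.
(* [bounded_fun] gives a bound by every real strictly above [K], hence the choice of [K + 1]. *)
move=> LX [K [_ XK]]; set M := K + 1.
have XM w : `|X w| <= M by apply: (XK M) => //; rewrite ltrDl.
split.
- by exists M; apply: VaR_set_ub => // w; exact: le_trans (ler_norm _) (XM w).
- by exists (- M); apply: VaR_set_lbound => // w; exact/lerNnormlW.
Qed.

(** The value [c] is both a member and a lower bound of the set, hence its minimum. *)
Lemma inf_VaR_set_cst (c : R) : L (cst c) -> inf (VaR_set alpha P (cst c)) = c.
Proof.
move=> Lc; have lbc := VaR_set_lbound Lc (fun=> lexx c).
have Vc := VaR_set_ub Lc (fun=> lexx c).
apply/eqP; rewrite eq_le; apply/andP; split.
  by apply: ge_inf => //; exists c.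
by apply: lb_le_inf => //; exists c.
Qed.

(** Since [event_le X x] is contained in [event_le Y (x + c)], shifting the set of [X] by [c] lands
    in the set of [Y]. Boundedness keeps both infima away from the default value of [inf]. *)
Lemma inf_VaR_set_le_shift (X Y : T -> R) (c : R) : L X -> L Y ->
  bounded_fun X -> bounded_fun Y -> (forall w, Y w <= X w + c) ->
  inf (VaR_set alpha P Y) <= inf (VaR_set alpha P X) + c.
Proof.
move=> LX LY bX bY YX; rewrite -lerBlDr.
apply: lb_le_inf => [|x Vx]; first by case: (has_inf_VaR_set LX bX).
rewrite lerBlDr; apply: ge_inf; first by case: (has_inf_VaR_set LY bY).
apply: (lt_le_trans Vx); apply: event_le_mono => // w Xwx.
by apply: le_trans (YX w) _; rewrite lerD2r.
Qed.

End Quantile.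

Theorem proposition16 (T : Type) (R : realType) (L : set (T -> R))
    (alpha : R) (P : set T -> R)
    (hL : linear_space_of_gambles L)
    (halpha : 0 < alpha < 1)
    (hP : probability_on (\bigcup_(X in L) range (event_le X)) P) :
  [/\ forall X, L X -> has_inf (VaR_set alpha P X),
      centered L (lower_prevision_VaR alpha P) &
      two_convex L (lower_prevision_VaR alpha P)].
Proof.
case: hL => Lb L0 _; split.
- by move=> X LX; apply: (has_inf_VaR_set hP) => //; exact: Lb.
- split=> //; rewrite lower_prevision_VaRE.
  exact: (inf_VaR_set_cst hP).
move=> X0 X1 LX0 LX1; rewrite leNgt; apply/negP.
set m0 := lower_prevision_VaR alpha P X0.
set m1 := lower_prevision_VaR alpha P X1 => sup_lt0.
have [r r0 ler] : exists2 r : R, r < 0 &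
    forall w, (X1 w - m1) - (X0 w - m0) <= r.
  (* A real bound [r] is extracted from the extended supremum: the supremum itself if finite, or -1
     if it is [-oo], its value over an empty range. The value [+oo] contradicts [sup_lt0]. *)
  have [r /andP[supr r0]] : exists r : R, (ereal_sup (range (fun w : T =>
      ((X1 w - m1) - (X0 w - m0))%:E)) <= r%:E)%E && (r < 0).
    case: (ereal_sup _) sup_lt0 => [s|//|_]; first by exists s; rewrite lexx.
    by exists (-1); rewrite leNye ltrN10.
  exists r => // w; rewrite -lee_fin; apply: le_trans supr.
  by apply: ereal_sup_ubound; exists w.
have : m1 <= m0 + (m1 - m0 + r).
  (* Only the two quantiles being compared become infima; the shift [m1 - m0 + r] is kept as the
     constant [c]. *)
  rewrite [leLHS]lower_prevision_VaRE [X in X + _]lower_prevision_VaRE.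
  apply: (inf_VaR_set_le_shift hP) => //; [exact: Lb|exact: Lb|].
  by move=> w; have := ler w; lra.
by lra.
Qed.
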